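(* Let $H=\mathbb Q^{C_4}\#\mathbb Q S_3$ be the bismash product Hopf algebra arising from the factorization of $S_4$ into $F=S_3$ (the subgroup fixing $4$) and $G=C_4=\langle(1\,2\,3\,4)\rangle$. The $24$-dimensional Hopf algebra $H$, of exponent $12$, contains elements of Hopf order $n$ for each $1\leq n\leq 10$ except $n=7$ and $n=10$ (for which it contains no element of Hopf order $n$). In particular, it contains elements whose Hopf order is a prime that does not divide the dimension (or the exponent) of $H$. The dual Hopf algebra $H^*$ contains elements of Hopf order $n$ for each $1\leq n\leq 10$ except $n=7$ and $n=9$ (for which it contains no element of Hopf order $n$). In particular, the Hopf orders of elements that occur in $H$ and its dual are different.
   Context: For a Hopf algebra $H$ with counit $\varepsilon$ and Sweedler notation $\Delta(h)=h_{(1)}\otimes h_{(2)}$, and a positive integer $n$, the $n$-th Hopf power of $h\in H$ is $h^{[n]}=h_{(1)}h_{(2)}\cdots h_{(n)}$; it is trivial if $h^{[n]}=\varepsilon(h)1$. The Hopf order of $h$ is the least positive integer $n$ such that the $n$-th Hopf power of $h$ is trivial. The exponent of $H$ is the least positive integer $n$ such that the $n$-th Hopf power of every element of $H$ is trivial. Permutations act on the left, $(\sigma\rho)(i)=\sigma(\rho(i))$. Every element of $S_4$ is uniquely a product of an element of $F=S_3$ (permutations fixing $4$) and an element of $G=\langle(1\,2\,3\,4)\rangle$ (in that order). For $a\in F$, $x\in G$ define $x\rhd a\in F$ and $x\lhd a\in G$ by $xa=(x\rhd a)(x\lhd a)$. The bismash product $\mathbb Q^{C_4}\#\mathbb Q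 S_3=\mathbb Q^G\#\mathbb Q F$ is the Hopf algebra over $\mathbb Q$ with basis $p_x\# a$ ($x\in G$, $a\in F$), where $$(p_x\# a)(p_y\# b)=\delta_{x\lhd a,y}\,p_x\# ab,\quad \Delta(p_x\# a)=\sum_{y\in G}\bigl(p_{xy^{-1}}\#(y\rhd a)\bigr)\otimes (p_y\# a),\quad \varepsilon(p_x\# a)=\delta_{1,x},$$ and unit element $\sum_{x\in G}p_x\# 1$. Its dual $H^*$ is isomorphic to a bismash product denoted $\mathbb Q^{S_3}\#\mathbb Q C_4$. *)

(* Defs.v *)
From HB Require Import structures.
From mathcomp Require Import all_boot all_order all_algebra all_fingroup.

Set Implicit Arguments.
Unset Strict Implicit.
Unset Printing Implicit Defensive.

Import GRing.Theory.
Local Open Scope ring_scope.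

Definition basis_vector (k : fieldType) (B : finType) (b : B) : {ffun B -> k^o} :=
  [ffun c => (c == b)%:R].

(* A finite-dimensional Hopf algebra over k is represented on a chosen basis B:
   a vector is its family of coordinates {ffun B -> k^o}, the tensor square
   has basis B * B, and the structure maps are given by their values on basis
   vectors.  Each axiom is the usual one, read off on basis vectors and
   coordinates.  The pointwise product that the library puts on {ffun B -> k^o}
   is never used. *)
Record hopf_algebra (k : fieldType) := HopfAlgebra {
  hbasis : finType;
  hmul : hbasis -> hbasis -> {ffun hbasis -> k^o};
  hone : {ffun hbasis -> k^o};
  hcomul : hbasis -> {ffun hbasis * hbasis -> k^o};
  hcounit : {ffun hbasis -> k^o};
  hantipode : hbasis -> {ffun hbasis -> k^o};
  hmulA : forall a b c d,
    \sum_u hmul a b u * hmul u c d = \sum_u hmul b c u * hmul a u d;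
  hmul1l : forall a c, \sum_u hone u * hmul u a c = (c == a)%:R;
  hmul1r : forall a c, \sum_u hone u * hmul a u c = (c == a)%:R;
  hcomulA : forall a b c d,
    \sum_u hcomul a (u, d) * hcomul u (b, c)
      = \sum_u hcomul a (b, u) * hcomul u (c, d);
  hcounitl : forall a c, \sum_u hcomul a (u, c) * hcounit u = (a == c)%:R;
  hcounitr : forall a c, \sum_u hcomul a (c, u) * hcounit u = (a == c)%:R;
  hcomulM : forall a b p q,
    \sum_u hmul a b u * hcomul u (p, q)
      = \sum_s \sum_t hcomul a s * hcomul b t
                        * (hmul s.1 t.1 p * hmul s.2 t.2 q);
  hcomul1 : forall p q, \sum_u hone u * hcomul u (p, q) = hone p * hone q;
  hcounitM : forall a b, \sum_u hmul a b u * hcounit u = hcounit a * hcounit b;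
  hcounit1 : \sum_u hone u * hcounit u = 1;
  hantipodel : forall a c,
    \sum_s hcomul a s * (\sum_u hantipode s.1 u * hmul u s.2 c)
      = hcounit a * hone c;
  hantipoder : forall a c,
    \sum_s hcomul a s * (\sum_u hantipode s.2 u * hmul s.1 u c)
      = hcounit a * hone c
}.

Definition hopf_space (k : fieldType) (H : hopf_algebra k) : vectType k :=
  {ffun hbasis H -> k^o}.
Coercion hopf_space : hopf_algebra >-> vectType.

Section HopfPowers.

Variables (k : fieldType) (H : hopf_algebra k).
Local Notation V := {ffun hbasis H -> k^o}.

Definition hprod (x y : V) : V := \sum_a \sum_b (x a * y b) *: hmul a b.

Definition heps (x : V) : k := \sum_a x a * hcounit H a.

(* The coefficient of e_(s_1) (x) ... (x) e_(s_n) in the iterated coproduct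
   b_(1) (x) ... (x) b_(n) of the basis vector b: n = 1 is the identity and
   n + 1 is obtained by (id (x) iterate n) o Delta.  For n = 0 it is the
   counit. *)
Fixpoint iter_comul (b : hbasis H) (s : seq (hbasis H)) : k :=
  match s with
  | [::] => hcounit H b
  | c :: s' =>
    if s' is [::] then (c == b)%:R
    else \sum_d hcomul b (c, d) * iter_comul d s'
  end.

Definition hopf_power (n : nat) (h : V) : V :=
  \sum_b \sum_(t : n.-tuple (hbasis H))
    (h b * iter_comul b t)
      *: \big[hprod/hone H]_(c <- t) basis_vector k c.

Definition hopf_power_trivial (n : nat) (h : V) : Prop :=
  hopf_power n h = heps h *: hone H.

Definition has_hopf_order (h : V) (n : nat) : Prop :=
  [/\ (0 < n)%N, hopf_power_trivial n h &
      forall m, (0 < m < n)%N -> ~ hopf_power_trivial m h].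

Definition has_exponent (n : nat) : Prop :=
  [/\ (0 < n)%N, forall h, hopf_power_trivial n h &
      forall m, (0 < m < n)%N -> ~ (forall h, hopf_power_trivial m h)].

End HopfPowers.

Arguments has_hopf_order {k} H h n.
Arguments has_exponent {k} H n.

Section Dual.

Variables (k : fieldType) (H : hopf_algebra k).
Local Notation B := (hbasis H).

(* In the dual basis, a functional f on H has coordinates b |-> f (e_b), and
   the structure maps are the transposes of those of H:
   (f g)(h) = f(h_(1)) g(h_(2)), Delta(f)(h (x) h') = f(h h'), 1 = epsilon,
   epsilon(f) = f(1). *)
Definition dual_mul (a b : B) : {ffun B -> k^o} := [ffun c => hcomul c (a, b)].
Definition dual_comul (c : B) : {ffun B * B -> k^o} := [ffun p => hmul p.1 p.2 c].
Definition dual_antipode (a : B) : {ffun B -> k^o} := [ffun b => hantipode b a].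

Let mulC' (x y : k^o) : x * y = y * x. Proof. exact: mulrC. Qed.

Fact dual_mulA a b c d :
  \sum_u dual_mul a b u * dual_mul u c d = \sum_u dual_mul b c u * dual_mul a u d.
Proof.
under eq_bigr do rewrite !ffunE mulC'.
by rewrite hcomulA; apply: eq_bigr => u _; rewrite !ffunE mulC'.
Qed.

Fact dual_mul1l a c : \sum_u hcounit H u * dual_mul u a c = (c == a)%:R.
Proof. by rewrite -hcounitl; apply: eq_bigr => u _; rewrite ffunE mulC'. Qed.

Fact dual_mul1r a c : \sum_u hcounit H u * dual_mul a u c = (c == a)%:R.
Proof. by rewrite -hcounitr; apply: eq_bigr => u _; rewrite ffunE mulC'. Qed.

Fact dual_comulA a b c d :
  \sum_u dual_comul a (u, d) * dual_comul u (b, c)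
    = \sum_u dual_comul a (b, u) * dual_comul u (c, d).
Proof.
under eq_bigr do rewrite !ffunE mulC' /=.
by rewrite hmulA; apply: eq_bigr => u _; rewrite !ffunE mulC'.
Qed.

Fact dual_counitl a c : \sum_u dual_comul a (u, c) * hone H u = (a == c)%:R.
Proof. by rewrite -hmul1l; apply: eq_bigr => u _; rewrite ffunE mulC'. Qed.

Fact dual_counitr a c : \sum_u dual_comul a (c, u) * hone H u = (a == c)%:R.
Proof. by rewrite -hmul1r; apply: eq_bigr => u _; rewrite ffunE mulC'. Qed.

Fact dual_comulM a b p q :
  \sum_u dual_mul a b u * dual_comul u (p, q)
    = \sum_s \sum_t dual_comul a s * dual_comul b t
                      * (dual_mul s.1 t.1 p * dual_mul s.2 t.2 q).
Proof.
under eq_bigr do rewrite !ffunE mulC' /=.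
rewrite hcomulM.
transitivity (\sum_(v : (B * B) * (B * B)) hcomul p v.1 * hcomul q v.2
   * (hmul v.1.1 v.2.1 a * hmul v.1.2 v.2.2 b)).
  by rewrite pair_bigA.
rewrite pair_bigA /=.
pose f (v : (B * B) * (B * B)) := ((v.1.1, v.2.1), (v.1.2, v.2.2)).
have fK : involutive f by move=> [[? ?] [? ?]].
rewrite (reindex f) /=; last by exists f => v _; apply: fK.
by apply: eq_bigr => -[[s1 s2] [t1 t2]] _; rewrite !ffunE /= mulC'.
Qed.

Fact dual_comul1 p q :
  \sum_u hcounit H u * dual_comul u (p, q) = hcounit H p * hcounit H q.
Proof. by rewrite -hcounitM; apply: eq_bigr => u _; rewrite ffunE mulC'. Qed.

Fact dual_counitM a b : \sum_u dual_mul a b u * hone H u = hone H a * hone H b.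
Proof. by rewrite -hcomul1; apply: eq_bigr => u _; rewrite ffunE mulC'. Qed.

Fact dual_counit1 : \sum_u hcounit H u * hone H u = 1.
Proof. by rewrite -(hcounit1 H); apply: eq_bigr => u _; rewrite mulC'. Qed.

Fact dual_antipodel a c :
  \sum_s dual_comul a s * (\sum_u dual_antipode s.1 u * dual_mul u s.2 c)
    = hone H a * hcounit H c.
Proof.
rewrite mulC' -hantipodel.
under eq_bigr do rewrite big_distrr.
under [RHS]eq_bigr do rewrite big_distrr.
rewrite !pair_bigA /=.
pose f (v : (B * B) * B) := ((v.2, v.1.2), v.1.1).
have fK : involutive f by move=> [[? ?] ?].
rewrite (reindex f) /=; last by exists f => v _; apply: fK.
apply: eq_bigr => -[[s1 s2] u] _; rewrite !ffunE /=.
by rewrite mulC' -mulrA [LHS]mulrCA mulrA.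
Qed.

Fact dual_antipoder a c :
  \sum_s dual_comul a s * (\sum_u dual_antipode s.2 u * dual_mul s.1 u c)
    = hone H a * hcounit H c.
Proof.
rewrite mulC' -hantipoder.
under eq_bigr do rewrite big_distrr.
under [RHS]eq_bigr do rewrite big_distrr.
rewrite !pair_bigA /=.
pose f (v : (B * B) * B) := ((v.1.1, v.2), v.1.2).
have fK : involutive f by move=> [[? ?] ?].
rewrite (reindex f) /=; last by exists f => v _; apply: fK.
apply: eq_bigr => -[[s1 s2] u] _; rewrite !ffunE /=.
by rewrite mulC' -mulrA [LHS]mulrCA mulrA.
Qed.

Definition hopf_dual : hopf_algebra k :=
  HopfAlgebra dual_mulA dual_mul1l dual_mul1r dual_comulA dual_counitl
    dual_counitr dual_comulM dual_comul1 dual_counitM dual_counit1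
    dual_antipodel dual_antipoder.

End Dual.

(* Bismash product k^G # kF for an exact factorization gT = F G. *)
Section Bismash.

Variables (k : fieldType) (gT : finGroupType) (F G : {group gT}).
Hypothesis FG : (G \in [complements to F in [set: gT]])%g.

(* x a = (x \rhd a) (x \lhd a) with x \rhd a in F and x \lhd a in G. *)
Definition mp_left (x : [subg G]) (a : [subg F]) : [subg F] :=
  subg F (divgr F G (sgval x * sgval a)%g).
Definition mp_right (x : [subg G]) (a : [subg F]) : [subg G] :=
  subg G (remgr F G (sgval x * sgval a)%g).

Local Notation "x \rhd a" := (mp_left x a) (at level 45).
Local Notation "x \lhd a" := (mp_right x a) (at level 45).
Local Notation B := ([subg G] * [subg F])%type.
Local Notation e := (@basis_vector k _).

Definition bismash_mul (p q : B) : {ffun B -> k^o} :=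
  (p.1 \lhd p.2 == q.1)%:R *: e (p.1, (p.2 * q.2)%g).
Definition bismash_one : {ffun B -> k^o} := \sum_(x : [subg G]) e (x, 1%g).
Definition bismash_comul (p : B) : {ffun B * B -> k^o} :=
  \sum_(y : [subg G]) e (((p.1 * y^-1)%g, y \rhd p.2), (y, p.2)).
Definition bismash_counit : {ffun B -> k^o} := [ffun p : B => (1%g == p.1)%:R].
Definition bismash_antipode (p : B) : {ffun B -> k^o} :=
  e ((p.1 \lhd p.2)^-1%g, (p.1 \rhd p.2)^-1%g).

Lemma mp_factor (x : [subg G]) (a : [subg F]) :
  (sgval x * sgval a = sgval (x \rhd a) * sgval (x \lhd a))%g.
Proof.
have /complP[_ defT] := FG.
have xaP : (sgval x * sgval a)%g \in (F * G)%g by rewrite defT inE.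
by rewrite !subgK ?mem_divgr ?mem_remgr // -divgr_eq.
Qed.

Lemma mp_uniq (x y : [subg G]) (a b : [subg F]) :
  (sgval x * sgval a = sgval b * sgval y)%g -> (x \rhd a = b) /\ (x \lhd a = y).
Proof.
have /complP[tiFG _] := FG; move=> eq_xa; rewrite /mp_left /mp_right eq_xa.
by rewrite (divgrMid tiFG) ?(remgrMid tiFG) ?subgP // !sgvalK.
Qed.

Local Open Scope group_scope.

Lemma mp_left1 a : 1 \rhd a = a.
Proof. by have [] := @mp_uniq 1 1 a a (etrans (mul1g _) (esym (mulg1 _))). Qed.
Lemma mp_right1 a : 1 \lhd a = 1.
Proof. by have [] := @mp_uniq 1 1 a a (etrans (mul1g _) (esym (mulg1 _))). Qed.
Lemma mp_left_1 x : x \rhd 1 = 1.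
Proof. by have [] := @mp_uniq x x 1 1 (etrans (mulg1 _) (esym (mul1g _))). Qed.
Lemma mp_right_1 x : x \lhd 1 = x.
Proof. by have [] := @mp_uniq x x 1 1 (etrans (mulg1 _) (esym (mul1g _))). Qed.

Lemma mp_mulr x a b :
  (x \rhd (a * b) = (x \rhd a) * ((x \lhd a) \rhd b)) /\ (x \lhd (a * b) = (x \lhd a) \lhd b).
Proof. by apply: mp_uniq; rewrite /= mulgA mp_factor -!mulgA mp_factor. Qed.
Lemma mp_leftM x a b : x \rhd (a * b) = (x \rhd a) * ((x \lhd a) \rhd b).
Proof. by have [] := mp_mulr x a b. Qed.
Lemma mp_rightM x a b : x \lhd (a * b) = (x \lhd a) \lhd b.
Proof. by have [] := mp_mulr x a b. Qed.

Lemma mp_mull x y a :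
  ((x * y) \rhd a = x \rhd (y \rhd a)) /\ ((x * y) \lhd a = (x \lhd (y \rhd a)) * (y \lhd a)).
Proof. by apply: mp_uniq; rewrite /= -mulgA mp_factor mulgA mp_factor mulgA. Qed.
Lemma mp_leftMl x y a : (x * y) \rhd a = x \rhd (y \rhd a).
Proof. by have [] := mp_mull x y a. Qed.
Lemma mp_rightMl x y a : (x * y) \lhd a = (x \lhd (y \rhd a)) * (y \lhd a).
Proof. by have [] := mp_mull x y a. Qed.

Lemma mp_right_div x y a : (x * y^-1) \lhd (y \rhd a) = (x \lhd a) * (y \lhd a)^-1.
Proof. by apply: (mulIg (y \lhd a)); rewrite -mp_rightMl !mulgKV. Qed.
Lemma mp_left_div x y a : (x * y^-1) \rhd (y \rhd a) = x \rhd a.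
Proof. by rewrite -mp_leftMl mulgKV. Qed.
Lemma mp_right_inj a : injective (fun x => x \lhd a).
Proof.
move=> x y /= eq_xy; rewrite -[x]mp_right_1 -[y]mp_right_1 -(mulgV a).
by rewrite !mp_rightM eq_xy.
Qed.

Local Close Scope group_scope.

Lemma sum_basis (I : finType) (c : I) (f : I -> k) :
  \sum_u (u == c)%:R * f u = f c.
Proof.
rewrite (bigD1 c) //= eqxx mul1r big1 ?addr0 // => u /negPf->.
by rewrite mul0r.
Qed.

Lemma bmulE p q u :
  bismash_mul p q u = (p.1 \lhd p.2 == q.1)%:R * (u == (p.1, (p.2 * q.2)%g))%:R.
Proof. by rewrite !ffunE. Qed.

Lemma boneE u : bismash_one u = (u.2 == 1%g)%:R.
Proof.
case: u => y a; rewrite sum_ffunE (bigD1 y) //= ffunE xpair_eqE eqxx.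
rewrite big1 ?addr0 // => x /negPf neq_xu.
by rewrite ffunE xpair_eqE eq_sym neq_xu.
Qed.

Lemma bcomulE p u v :
  bismash_comul p (u, v) = (v.2 == p.2)%:R * (u == ((p.1 * v.1^-1)%g, v.1 \rhd p.2))%:R.
Proof.
rewrite sum_ffunE (bigD1 v.1) //= ffunE big1 ?addr0.
  by case: v => y a; rewrite !xpair_eqE /= eqxx /= -natrM mulnb andbC.
move=> y /negPf neq_yv; rewrite ffunE; case: v neq_yv => z a /= neq_yz.
by rewrite !xpair_eqE [z == y]eq_sym neq_yz /= andbF.
Qed.

Lemma sum_bmul p q (f : B -> k) :
  \sum_u bismash_mul p q u * f u = (p.1 \lhd p.2 == q.1)%:R * f (p.1, (p.2 * q.2)%g).
Proof.
rewrite -[f (_, _)]sum_basis big_distrr.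
by apply: eq_bigr => u _; rewrite bmulE /= mulrA.
Qed.

Lemma sum_bone (f : B -> k) : \sum_u bismash_one u * f u = \sum_x f (x, 1%g).
Proof.
under eq_bigr do rewrite sum_ffunE big_distrl.
rewrite exchange_big; apply: eq_bigr => x _ /=.
by rewrite -[RHS]sum_basis; apply: eq_bigr => u _; rewrite ffunE.
Qed.

Lemma sum_bcomul p (f : B * B -> k) :
  \sum_s bismash_comul p s * f s
    = \sum_y f (((p.1 * y^-1)%g, y \rhd p.2), (y, p.2)).
Proof.
under eq_bigr do rewrite sum_ffunE big_distrl.
rewrite exchange_big; apply: eq_bigr => x _ /=.
by rewrite -[RHS]sum_basis; apply: eq_bigr => u _; rewrite ffunE.
Qed.

Lemma sum_bcomull p v (f : B -> k) :
  \sum_u bismash_comul p (u, v) * f u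
    = (v.2 == p.2)%:R * f ((p.1 * v.1^-1)%g, v.1 \rhd p.2).
Proof.
rewrite -[f (_, _)]sum_basis big_distrr.
by apply: eq_bigr => u _; rewrite bcomulE /= mulrA.
Qed.

Lemma sum_bantipode p (f : B -> k) :
  \sum_u bismash_antipode p u * f u = f ((p.1 \lhd p.2)^-1%g, (p.1 \rhd p.2)^-1%g).
Proof. by rewrite -[RHS]sum_basis; apply: eq_bigr => u _; rewrite ffunE. Qed.

Fact bismash_mulA a b c d :
  \sum_u bismash_mul a b u * bismash_mul u c d = \sum_u bismash_mul b c u * bismash_mul a u d.
Proof.
rewrite !sum_bmul !bmulE /= mp_rightM mulgA !mulrA -!natrM !mulnb.
by case: (a.1 \lhd a.2 =P b.1) => [->|_] /=; rewrite ?andbT ?andbF.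
Qed.

Fact bismash_mul1l a c : \sum_u bismash_one u * bismash_mul u a c = (c == a)%:R.
Proof.
rewrite sum_bone; under eq_bigr do rewrite bmulE /= mp_right_1 mul1g.
by rewrite (sum_basis a.1 (fun x => (c == (x, a.2))%:R)); case: (a).
Qed.

Fact bismash_mul1r a c : \sum_u bismash_one u * bismash_mul a u c = (c == a)%:R.
Proof.
rewrite sum_bone; under eq_bigr do rewrite bmulE /= eq_sym mulg1.
by rewrite sum_basis; case: (a).
Qed.

Fact bismash_comulA a b c d :
  \sum_u bismash_comul a (u, d) * bismash_comul u (b, c)
    = \sum_u bismash_comul a (b, u) * bismash_comul u (c, d).
Proof.
rewrite sum_bcomull bcomulE /=.
transitivity (\sum_u (u == ((c.1 * d.1)%g, a.2))%:R * (bismash_comul a (b, u) * bismash_comul u (c, d))).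
  rewrite sum_basis !bcomulE /= eqxx mul1r mulgK invMg mulgA mp_leftMl.
  case: c => y c2 /=; rewrite xpair_eqE eqxx /=.
  by case: (d.2 == _); case: (c2 == _); rewrite ?mul1r ?mulr1 ?mul0r ?mulr0.
apply: eq_bigr => u _; case: eqP => [->|neq_u]; first by rewrite mul1r.
rewrite mul0r !bcomulE; case: eqP => [eq_u2|_]; last by rewrite !mul0r.
case: (c =P _) => [eq_c|_]; last by rewrite !mulr0.
case: neq_u; rewrite eq_c /= mulgKV -eq_u2; by case: (u).
Qed.

Fact bismash_counitl a c : \sum_u bismash_comul a (u, c) * bismash_counit u = (a == c)%:R.
Proof.
rewrite sum_bcomull ffunE /= -natrM mulnb [a == c]eq_sym.
case: a c => [x a] [y b] /=; rewrite xpair_eqE andbC; congr ((_ && _)%:R).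
by rewrite eq_sym -eq_mulgV1 eq_sym.
Qed.

Fact bismash_counitr a c : \sum_u bismash_comul a (c, u) * bismash_counit u = (a == c)%:R.
Proof.
transitivity (\sum_u (u == (1%g, a.2))%:R * bismash_comul a (c, u)).
  apply: eq_bigr => -[y b] _; rewrite ffunE bcomulE /= xpair_eqE [1%g == y]eq_sym.
  by case: (y == _); case: (b == _); rewrite ?mul1r ?mulr1 ?mul0r ?mulr0.
rewrite sum_basis bcomulE /= eqxx mul1r invg1 mulg1 mp_left1 eq_sym.
by case: (a).
Qed.

Fact bismash_comulM a b p q :
  \sum_u bismash_mul a b u * bismash_comul u (p, q)
    = \sum_s \sum_t bismash_comul a s * bismash_comul b t
                      * (bismash_mul s.1 t.1 p * bismash_mul s.2 t.2 q).
Proof.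
rewrite sum_bmul bcomulE /=.
transitivity (\sum_s bismash_comul a s *
    (\sum_t bismash_comul b t * (bismash_mul s.1 t.1 p * bismash_mul s.2 t.2 q))); last first.
  by apply: eq_bigr => s _; rewrite big_distrr; apply: eq_bigr => t _ /=; rewrite mulrA.
rewrite sum_bcomul.
under eq_bigr do rewrite sum_bcomul /=.
rewrite (bigD1 q.1) //= [X in _ + X]big1 ?addr0; last first.
  move=> y /negPf neq_y; apply: big1 => z _; rewrite [X in _ * X]bmulE /=.
  by case: (q) neq_y => q1 q2 /=; rewrite eq_sym xpair_eqE => ->; rewrite !mulr0.
rewrite (bigD1 (q.1 \lhd a.2)) //= [X in _ + X]big1 ?addr0; last first.
  move=> z /negPf neq_z; rewrite [X in _ * X]bmulE /=.
  by rewrite eq_sym neq_z !mul0r mulr0.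
rewrite !bmulE /= mp_right_div eqxx mul1r mp_leftM (inj_eq (mulIg _)).
case: q => y c /=; rewrite !xpair_eqE eqxx /= -!mulrA; congr (_ * _).
by rewrite mulrC.
Qed.

Fact bismash_comul1 p q :
  \sum_u bismash_one u * bismash_comul u (p, q) = bismash_one p * bismash_one q.
Proof.
rewrite sum_bone; under eq_bigr do rewrite bcomulE /= mp_left_1.
rewrite -big_distrr /= !boneE mulrC; congr (_ * _).
rewrite (bigD1 (p.1 * q.1)%g) //= mulgK big1 ?addr0.
  by case: p => x a /=; rewrite xpair_eqE eqxx.
move=> x /eqP neq_x; case: eqP => // eq_p; case: neq_x.
by rewrite eq_p /= mulgKV.
Qed.

Fact bismash_counitM a b :
  \sum_u bismash_mul a b u * bismash_counit u = bismash_counit a * bismash_counit b.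
Proof.
rewrite sum_bmul !ffunE /= mulrC -!natrM !mulnb.
by case: eqP => //= <-; rewrite mp_right1.
Qed.

Fact bismash_counit1 : \sum_u bismash_one u * bismash_counit u = 1.
Proof.
rewrite sum_bone (bigD1 1%g) //= ffunE eqxx big1 ?addr0 // => x /negPf neq_x.
by rewrite ffunE eq_sym neq_x.
Qed.

Fact bismash_antipodel a c :
  \sum_s bismash_comul a s * (\sum_u bismash_antipode s.1 u * bismash_mul u s.2 c)
    = bismash_counit a * bismash_one c.
Proof.
rewrite sum_bcomul; under eq_bigr do rewrite sum_bantipode bmulE /=.
under eq_bigr => y _.
  rewrite mp_right_div mp_left_div invMg invgK.
  rewrite -[((y \lhd a.2) * _)%g]mp_right_div -mp_rightM mulgV mp_right_1.
  over.
rewrite /= ffunE boneE eq_sym.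
case: (a.1 =P 1%g) => [a1|neq_a1]; last first.
  rewrite mul0r big1 // => y _; case: eqP; last by rewrite mul0r.
  by move/(canRL (mulKg _)); rewrite mulVg => /eqP; rewrite invg_eq1 => /eqP.
rewrite [RHS]mul1r a1 mp_left1.
under eq_bigr do rewrite invg1 mulg1 eqxx [_ * _]mul1r mulVg.
rewrite (reindex_inj (@mp_right_inj a.2^-1%g)) /=.
under eq_bigr do rewrite -mp_rightM mulVg mp_right_1.
by rewrite -boneE sum_ffunE; apply: eq_bigr => y _; rewrite ffunE.
Qed.

Fact bismash_antipoder a c :
  \sum_s bismash_comul a s * (\sum_u bismash_antipode s.2 u * bismash_mul s.1 u c)
    = bismash_counit a * bismash_one c.
Proof.
rewrite sum_bcomul; under eq_bigr do rewrite sum_bantipode bmulE /=.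
under eq_bigr => y _ do rewrite mp_right_div mulgV -[X in _ == X]mul1g (inj_eq (mulIg _)).
have -> : (a.1 \lhd a.2 == 1%g) = (a.1 == 1%g).
  by rewrite -[RHS](inj_eq (@mp_right_inj a.2)) /= mp_right1.
rewrite -big_distrr ffunE /= [1%g == _]eq_sym.
case: (a.1 =P 1%g) => [->|_]; last by rewrite !mul0r.
rewrite [LHS]mul1r [RHS]mul1r (reindex_inj invg_inj) /=.
under eq_bigr do rewrite invgK mul1g.
by rewrite sum_ffunE; apply: eq_bigr => y _; rewrite ffunE.
Qed.

Definition bismash : hopf_algebra k :=
  HopfAlgebra bismash_mulA bismash_mul1l bismash_mul1r bismash_comulA
    bismash_counitl bismash_counitr bismash_comulM bismash_comul1
    bismash_counitM bismash_counit1 bismash_antipodel bismash_antipoder.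

End Bismash.

(* The library multiplies permutations from left to right, (s * t) i = t (s i).
   The product (s * t) i = s (t i) is put on an alias of {perm T}. *)
Definition lperm (T : finType) : predArgType := {perm T}.

Section LeftPermutations.

Variable T : finType.
Implicit Types s t : {perm T}.

Definition lperm_mul s t : {perm T} := (t * s)%g.

Fact lperm_mulA : associative lperm_mul.
Proof. by move=> s t u; rewrite /lperm_mul mulgA. Qed.
Fact lperm_mul1 : left_id 1%g lperm_mul.
Proof. by move=> s; rewrite /lperm_mul mulg1. Qed.
Fact lperm_mulV : left_inverse 1%g (@invg {perm T}) lperm_mul.
Proof. by move=> s; rewrite /lperm_mul mulgV. Qed.

HB.instance Definition _ := Finite.on (lperm T).
HB.instance Definition _ :=
  Finite_isGroup.Build (lperm T) lperm_mulA lperm_mul1 lperm_mulV.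

Lemma lpermM (s t : lperm T) (i : T) :
  ((s * t)%g : {perm T}) i = (s : {perm T}) ((t : {perm T}) i).
Proof. exact: permM. Qed.

Lemma lperm1 (i : T) : ((1%g : lperm T) : {perm T}) i = i.
Proof. exact: perm1. Qed.

End LeftPermutations.

(* S_4 acts on 'I_4 = {0, 1, 2, 3},
   where i stands for the point i + 1 of {1, 2, 3, 4}. *)
Local Notation S4 := (lperm 'I_4).

Definition S3_set : {set S4} := [set s : S4 | (s : {perm 'I_4}) ord_max == ord_max].

Fact S3_group_set : group_set S3_set.
Proof.
apply/group_setP; split=> [|s t]; first by rewrite inE lperm1.
by rewrite !inE lpermM => /eqP fs /eqP ->; rewrite fs.
Qed.

Definition S3 : {group S4} := Group S3_group_set.

Definition cycle4 : S4 := perm (@ordS_inj 4).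

Definition C4 : {group S4} := <[cycle4]>%G.

Lemma cycle4X n (i : 'I_4) :
  nat_of_ord (((cycle4 ^+ n)%g : {perm 'I_4}) i) = ((i + n) %% 4)%N.
Proof.
elim: n => [|n IHn]; first by rewrite expg0 lperm1 addn0 modn_small.
by rewrite expgS lpermM permE /= IHn -addn1 modnDml addn1 addnS.
Qed.

Fact S3_C4_factorization : (C4 \in [complements to S3 in [set: S4]])%g.
Proof.
apply/complP; split; apply/setP=> s.
  rewrite !inE; apply/andP/eqP => [[fix_s /cycleP[n def_s]]|->]; last first.
    by rewrite lperm1 group1.
  apply/permP=> i; apply: val_inj; rewrite lperm1 def_s /= cycle4X.
  have : val ((s : {perm 'I_4}) ord_max) = 3%N by rewrite (eqP fix_s).
  rewrite def_s /= cycle4X => n4.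
  have dv : (n %% 4 = 0)%N.
    have := ltn_pmod n (isT : 0 < 4)%N; rewrite -modnDmr in n4.
    by case: (n %% 4)%N n4 => [|[|[|[|m]]]].
  by rewrite -modnDmr dv addn0 modn_small.
rewrite inE; pose m := val ((s^-1 : {perm 'I_4})%g ord_max).
apply/mulsgP; exists (s * (cycle4 ^+ (m + 1)))%g ((cycle4 ^+ (m + 1))^-1)%g.
- rewrite inE lpermM; have -> : ((cycle4 ^+ (m + 1))%g : {perm 'I_4}) ord_max
    = (s^-1 : {perm 'I_4})%g ord_max.
    by apply: val_inj; rewrite /= cycle4X /m /= addnC -addnA modnDr modn_small.
  by rewrite permKV.
- by rewrite groupV mem_cycle.
by rewrite mulgK.
Qed.

Definition bismash_C4_S3 : hopf_algebra rat := bismash rat S3_C4_factorization.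

(* Main.v *)
Require Import Defs.
From mathcomp Require Import all_boot all_order all_algebra all_fingroup.

(** For a fixed n the n-th Hopf power h |-> h^[n] is linear, so the elements
    whose n-th power is trivial form a subspace K_n, the kernel of the
    endomorphism h |-> h^[n] - eps(h) 1, called the n-th defect below. An
    element of Hopf order n is an element of K_n outside all K_m with 0 < m < n.
    Hence n is not a Hopf order as soon as K_n is contained in one earlier K_m,
    and n is a Hopf order as soon as one suitable vector is exhibited. The whole
    statement is linear algebra in dimension 24 once the matrices of the Hopf
    powers are known.

    These matrices have entries 0 and 1 for a bismash product. Applying the
    coproduct and then a multiplication from the left, the coefficient of
    p_u # w in (p_x # a)^[n+1] receives a contribution from a single summand of
    Delta(p_x # a), the one indexed by y = u^-1 x, and there from a single basis
    vector of the n-th power. So the coefficient equals a coefficient of the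
    n-th power at other indices ([hopf_coef_bismash]), and iterating ends at the
    zeroth power eps(p_x # a) 1. Transposing the matrices gives the Hopf powers
    of the dual ([hopf_coef_dual]), because the product and the coproduct of the
    dual are the transposes of the coproduct and the product.

    For S_4 = S_3 C_4 the recursion is carried out on lists of numbers: a
    permutation becomes the list of its values, and the two actions of the
    matched pair become explicit functions of lists ([mp_code]). Three kinds of
    facts are then decided by computation. A witness for the order n is a
    combination of at most six basis vectors. The inclusions K_7 <= K_6 and
    K_10 <= K_6 for the bismash product, and K_7 <= K_6 and K_9 <= K_6 for its
    dual, hold because every nonzero coordinate of the sixth defect is a
    signed sum of at most three coordinates of the seventh, tenth or ninth one.
    The twelfth defect is zero, and a basis vector of order 12 shows that no
    smaller positive integer is the exponent. *)

Set Implicit Arguments.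
Unset Strict Implicit.
Unset Printing Implicit Defensive.

Import GRing.Theory Num.Theory.
Local Open Scope ring_scope.

(** * Matrices of Hopf powers *)

Lemma big_tuple_cons (V : nmodType) (T : finType) (n : nat)
    (f : n.+1.-tuple T -> V) :
  \sum_(t : n.+1.-tuple T) f t
    = \sum_(c : T) \sum_(t : n.-tuple T) f [tuple of c :: t].
Proof.
rewrite pair_bigA (reindex (fun p : T * n.-tuple T => [tuple of p.1 :: p.2])) //.
exists (fun t => (thead t, [tuple of behead t])) => [[c t] | t] _ /=.
  by congr (_, _); apply: val_inj.
by rewrite [RHS]tuple_eta.
Qed.

Section HopfCoefficients.

Variables (k : fieldType) (H : hopf_algebra k).
Local Notation B := (hbasis H).
Local Notation V := {ffun B -> k^o}.

Definition basis_power (n : nat) (b : B) : V :=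
  \sum_(t : n.-tuple B)
    iter_comul b t *: \big[@hprod k H/hone H]_(c <- t) basis_vector k c.

Definition hopf_coef (n : nat) (b c : B) : k := basis_power n b c.

(** The counit axiom makes the iterated coproduct obey one recursion, starting
    from the counit at the empty list, without a special case for length 1. *)
Lemma iter_comul_cons (b c : B) s :
  iter_comul b (c :: s) = \sum_d hcomul b (c, d) * iter_comul d s.
Proof. by case: s => [|d s] //=; rewrite hcounitr eq_sym. Qed.

Lemma hprodZr (x y : V) (a : k) : hprod x (a *: y) = a *: hprod x y.
Proof.
rewrite /hprod scaler_sumr; apply: eq_bigr => u _.
rewrite scaler_sumr; apply: eq_bigr => v _.
by rewrite !ffunE scalerA mulrCA.
Qed.

Lemma hprod_sumr (I : finType) (x : V) (F : I -> V) :
  hprod x (\sum_i F i) = \sum_i hprod x (F i).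
Proof.
rewrite /hprod [RHS]exchange_big; apply: eq_bigr => u _.
rewrite [RHS]exchange_big; apply: eq_bigr => v _.
by rewrite sum_ffunE mulr_sumr scaler_suml.
Qed.

Lemma hprod_basisl (b : B) (y : V) :
  hprod (basis_vector k b) y = \sum_u y u *: hmul b u.
Proof.
rewrite /hprod (bigD1 b) //= [X in _ + X]big1 ?addr0 => [|a /negPf neq_ab].
  by apply: eq_bigr => u _; rewrite ffunE eqxx mul1r.
by apply: big1 => u _; rewrite ffunE neq_ab mul0r scale0r.
Qed.

Lemma basis_power0 (b : B) : basis_power 0 b = hcounit H b *: hone H.
Proof.
rewrite /basis_power (big_pred1 [tuple]) => [|t]; last by apply/esym/eqP/tuple0.
by rewrite big_nil.
Qed.

(** The Hopf powers are the convolution powers of the identity, so the n+1-st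
    is the convolution of the identity with the n-th. *)
Lemma basis_powerS (n : nat) (b : B) :
  basis_power n.+1 b
    = \sum_p hcomul b p *: hprod (basis_vector k p.1) (basis_power n p.2).
Proof.
rewrite /basis_power big_tuple_cons.
transitivity (\sum_c \sum_d hcomul b (c, d)
    *: hprod (basis_vector k c) (basis_power n d)); last first.
  by rewrite pair_bigA; apply: eq_bigr => -[].
apply: eq_bigr => c _.
under eq_bigr do rewrite iter_comul_cons scaler_suml big_cons.
rewrite exchange_big; apply: eq_bigr => d _.
rewrite hprod_sumr scaler_sumr; apply: eq_bigr => t _.
by rewrite hprodZr scalerA.
Qed.

Lemma hopf_coef0 (b c : B) : hopf_coef 0 b c = hcounit H b * hone H c.
Proof. by rewrite /hopf_coef basis_power0 ffunE. Qed.

Lemma hopf_coefS (n : nat) (b c : B) :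
  hopf_coef n.+1 b c
    = \sum_p hcomul b p * \sum_u hopf_coef n p.2 u * hmul p.1 u c.
Proof.
rewrite /hopf_coef basis_powerS sum_ffunE; apply: eq_bigr => p _.
rewrite ffunE hprod_basisl sum_ffunE; congr (_ * _).
by apply: eq_bigr => u _; rewrite ffunE.
Qed.

Lemma hopf_powerE (n : nat) (h : V) (c : B) :
  hopf_power n h c = \sum_b h b * hopf_coef n b c.
Proof.
rewrite /hopf_power sum_ffunE; apply: eq_bigr => b _.
under eq_bigr do rewrite -scalerA.
by rewrite -scaler_sumr ffunE.
Qed.

(** The zeroth Hopf power is h |-> eps(h) 1, so triviality of the n-th power is
    a homogeneous system of linear equations whose matrix is the difference of
    the n-th and the zeroth coefficient matrix. *)
Lemma hopf_power_trivialP (n : nat) (h : V) :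
  hopf_power_trivial n h <->
  forall c, \sum_b h b * (hopf_coef n b c - hopf_coef 0 b c) = 0.
Proof.
have defect c : \sum_b h b * (hopf_coef n b c - hopf_coef 0 b c)
    = hopf_power n h c - (heps h *: hone H) c.
  under eq_bigr do rewrite mulrBr.
  rewrite sumrB -hopf_powerE; congr (_ - _).
  rewrite ffunE /heps [RHS]mulr_suml.
  by apply: eq_bigr => b _; rewrite hopf_coef0 mulrA.
split=> [triv c | eq0]; first by rewrite defect triv subrr.
by apply/ffunP=> c; apply/eqP; rewrite -subr_eq0 -defect eq0.
Qed.

End HopfCoefficients.

(** Transposition exchanges product and coproduct, and it leaves the recursion
    of [hopf_coefS] invariant: the triple sum over the two tensor factors and the
    intermediate basis vector is the same after exchanging the last two. *)
Lemma hopf_coef_dual (k : fieldType) (H : hopf_algebra k) (n : nat)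
    (b c : hbasis H) :
  hopf_coef (H := hopf_dual H) n b c = hopf_coef (H := H) n c b.
Proof.
elim: n => [|n IHn] in b c *; first by rewrite !hopf_coef0 mulrC.
rewrite !hopf_coefS.
under eq_bigr do rewrite mulr_sumr.
under [RHS]eq_bigr do rewrite mulr_sumr.
rewrite !pair_bigA /=.
pose f (v : (hbasis H * hbasis H) * hbasis H) := ((v.1.1, v.2), v.1.2).
have fK : involutive f by move=> [[? ?] ?].
rewrite (reindex f) /=; last by exists f => v _; apply: fK.
apply: eq_bigr => -[[s1 s2] u] _; rewrite IHn !ffunE /=.
by rewrite mulrCA [RHS]mulrCA; congr (_ * _); apply: mulrC.
Qed.

(** * Hopf powers in a bismash product *)

Section BismashCoefficients.

Variables (k : fieldType) (gT : finGroupType) (F G : {group gT}).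
Hypothesis FG : (G \in [complements to F in [set: gT]])%g.
Local Notation B := ([subg G] * [subg F])%type.

(** The coefficient of p_(q.1) # q.2 in the n-th Hopf power of
    p_(p.1) # p.2. *)
Fixpoint bismash_pow (n : nat) (p q : B) : bool :=
  if n is n'.+1 then
    let y := (q.1^-1 * p.1)%g in
    let b := mp_left y p.2 in
    bismash_pow n' (y, p.2) (mp_right q.1 b, (b^-1 * q.2)%g)
  else (p.1 == 1%g) && (q.2 == 1%g).

(** In Delta(p_x # a) the left factors p_(x y^-1) # (y |> a) have distinct first
    indices, and left multiplication by p_u # b only produces multiples of
    p_u # _, so y = u^-1 x is forced. Then
    (p_u # b)(p_v # c) = p_u # w forces v = u <| b and c = b^-1 w. *)
Lemma hopf_coef_bismash (n : nat) (p q : B) :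
  hopf_coef (H := bismash k FG) n p q = (bismash_pow n p q)%:R.
Proof.
elim: n => [|n IHn] in p q *.
  by rewrite hopf_coef0 /= boneE ffunE -natrM mulnb eq_sym.
rewrite hopf_coefS /= sum_bcomul /=.
set y := (q.1^-1 * p.1)%g.
rewrite (bigD1 y) //= [X in _ + X]big1 ?addr0 => [|z neq_zy]; last first.
  apply: big1 => v _; rewrite bmulE /=; case: q @y neq_zy => u w /= neq_zy.
  rewrite xpair_eqE; case: (u =P _) => [def_u | _]; last by rewrite !mulr0.
  by case/eqP: neq_zy; rewrite def_u invMg invgK mulgKV.
set b := mp_left y p.2.
have def_u : (p.1 * y^-1)%g = q.1 by rewrite /y invMg invgK mulKVg.
rewrite def_u -IHn -[RHS](sum_basis (mp_right q.1 b, (b^-1 * q.2)%g)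
   (fun v => hopf_coef (H := bismash k FG) n (y, p.2) v)).
apply: eq_bigr => -[v1 v2] _; rewrite mulrC bmulE; congr (_ * _).
rewrite -natrM mulnb; case: (q) => u w /=; rewrite !xpair_eqE eqxx /=.
rewrite eq_sym; congr ((_ && _)%:R).
by rewrite [RHS]eq_sym -[RHS](inj_eq (mulgI b)) mulKVg.
Qed.

End BismashCoefficients.

(** * Computing in the factorization S_4 = S_3 C_4 *)

Section Codes.
Local Open Scope nat_scope.
Local Notation S4 := (lperm 'I_4).
Local Notation B := ([subg C4] * [subg S3])%type.

Definition code (s : S4) : seq nat :=
  [seq val ((s : {perm 'I_4}) i) | i <- enum 'I_4].

(** A power c^i of the 4-cycle c adds i modulo 4, so its value at the first point
    recovers i. *)
Definition shift (x : S4) : nat := val ((x : {perm 'I_4}) ord0).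

Definition comp_code (l m : seq nat) : seq nat := [seq nth 0 l j | j <- m].

Definition shift_code (x : nat) : seq nat := [seq (j + x) %% 4 | j <- iota 0 4].

Definition S3_codes : seq (seq nat) :=
  [seq rcons l 3 | l <- permutations (iota 0 3)].

(** Let x a = b c^z with b fixing the last point 3. Then x a maps 3 - z to 3,
    which determines z, and the values of b are those of x a rotated by z
    places. *)
Definition right_code (x : nat) (l : seq nat) : nat :=
  3 - index 3 (comp_code (shift_code x) l).

Definition left_code (x : nat) (l : seq nat) : seq nat :=
  rotr (right_code x l) (comp_code (shift_code x) l).

(** The code of b^-1 w: the value b^-1 j is the position of j in the code of
    b. *)
Definition div_code (l m : seq nat) : seq nat := [seq index j l | j <- m].

Lemma nth_code (s : S4) (i : 'I_4) : nth 0 (code s) i = (s : {perm 'I_4}) i.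
Proof. by rewrite (nth_map i) ?size_enum_ord // nth_ord_enum. Qed.

Lemma code_inj : injective code.
Proof.
move=> s t eq_st; apply/permP=> i; apply: val_inj.
by rewrite /= -!nth_code eq_st.
Qed.

Lemma codeM (s t : S4) : code (s * t)%g = comp_code (code s) (code t).
Proof.
rewrite /comp_code -map_comp; apply: eq_map => i.
by rewrite /= nth_code lpermM.
Qed.

Lemma code1 : code 1%g = iota 0 4.
Proof. by rewrite -val_enum_ord; apply: eq_map => i; rewrite lperm1. Qed.

Lemma code_perm (s : S4) : code s \in permutations (iota 0 4).
Proof.
rewrite mem_permutations -val_enum_ord /code map_comp.
apply/perm_map/uniq_perm => [|| i]; rewrite ?enum_uniq //.
  by rewrite map_inj_uniq ?enum_uniq //; apply: perm_inj.
rewrite mem_enum -[i in i \in map _ _](permKV (s : {perm 'I_4})) map_f //.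
by rewrite mem_enum.
Qed.

Lemma code_S3 (s : S4) : s \in S3 -> code s \in S3_codes.
Proof.
rewrite inE => /eqP fix3.
have last3 : nth 0 (code s) 3 = 3 by rewrite (nth_code s ord_max) fix3.
have /allP/(_ _ (code_perm s)) : all (fun l => (nth 0 l 3 == 3) ==> (l \in S3_codes))
  (permutations (iota 0 4)) by vm_compute.
by rewrite last3.
Qed.

Lemma shift_lt (x : S4) : shift x \in iota 0 4.
Proof. by rewrite mem_iota ltn_ord. Qed.

Lemma C4E (x : S4) (i : 'I_4) :
  x \in C4 -> (x : {perm 'I_4}) i = (i + shift x) %% 4 :> nat.
Proof.
by case/cycleP=> m ->; rewrite /shift /= !cycle4X modnDmr.
Qed.

Lemma code_C4 (x : S4) : x \in C4 -> code x = shift_code (shift x).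
Proof.
move=> xC; rewrite /shift_code -val_enum_ord -map_comp; apply: eq_map => i.
exact: C4E.
Qed.

Lemma shift_div (u x : S4) :
  u \in C4 -> x \in C4 -> shift (u^-1 * x)%g = (shift x + 4 - shift u) %% 4.
Proof.
move=> uC xC; set y := (u^-1 * x)%g.
have yC : y \in C4 by rewrite groupM ?groupV.
have -> : shift x = (shift y + shift u) %% 4.
  by rewrite -C4E // -/(shift y) /shift /= -lpermM mulKVg.
have := shift_lt u; have := shift_lt y; rewrite !mem_iota /= !add0n.
by case: (shift y) => [|[|[|[|]]]] //; case: (shift u) => [|[|[|[|]]]].
Qed.

Lemma code_div (b w : S4) : code (b^-1 * w)%g = div_code (code b) (code w).
Proof.
move: (b^-1 * w)%g (mulKVg b w) => c <-.
rewrite codeM /div_code /comp_code -map_comp.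
rewrite -[LHS]map_id; apply/eq_in_map => j /mapP[i _ ->] /=.
rewrite index_uniq //; first by rewrite size_map size_enum_ord.
by rewrite map_inj_uniq ?enum_uniq // => i1 i2 /val_inj /perm_inj.
Qed.

(** The product x a has only one factorization in S_3 C_4, and this is visible on
    codes: running through all pairs of factors of x a with codes in the two
    finite lists leaves only the pair computed by [left_code] and
    [right_code]. *)
Lemma mp_code (x : [subg C4]) (a : [subg S3]) :
  code (sgval (mp_left x a)) = left_code (shift (sgval x)) (code (sgval a))
  /\ shift (sgval (mp_right x a)) = right_code (shift (sgval x)) (code (sgval a)).
Proof.
have /(congr1 code) := mp_factor S3_C4_factorization x a.
rewrite !codeM !(code_C4 (subgP _)).
have check : all (fun x => all (fun y => all (fun l => all (fun m =>
    (comp_code (shift_code x) l == comp_code m (shift_code y))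
      ==> (m == left_code x l) && (y == right_code x l))
  S3_codes) S3_codes) (iota 0 4)) (iota 0 4) by vm_compute.
move: check => /allP/(_ _ (shift_lt (sgval x)))/allP.
move=> /(_ _ (shift_lt (sgval (mp_right x a))))/allP.
move=> /(_ _ (code_S3 (subgP a)))/allP/(_ _ (code_S3 (subgP (mp_left x a)))).
by move=> + /eqP eq_xa; rewrite eq_xa => /andP[/eqP -> /eqP ->].
Qed.

Definition basis_code (p : B) : nat * seq nat :=
  (shift (sgval p.1), code (sgval p.2)).

Definition basis_codes : seq (nat * seq nat) :=
  [seq (x, l) | x <- iota 0 4, l <- S3_codes].

Fixpoint code_pow (n : nat) (p q : nat * seq nat) : bool :=
  if n is n'.+1 then
    let y := (p.1 + 4 - q.1) %% 4 in
    let b := left_code y p.2 in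
    code_pow n' (y, p.2) (right_code q.1 b, div_code b q.2)
  else (p.1 == 0) && (q.2 == iota 0 4).

Lemma shift_inj (x y : S4) :
  x \in C4 -> y \in C4 -> shift x = shift y -> x = y.
Proof. by move=> xC yC eq_xy; apply: code_inj; rewrite !code_C4 ?eq_xy. Qed.

Lemma basis_code_inj : injective basis_code.
Proof.
case=> [x a] [y b] [eq_xy eq_ab]; congr (_, _); apply: val_inj.
  exact: shift_inj (subgP _) (subgP _) eq_xy.
exact: code_inj.
Qed.

Lemma basis_code_mem (p : B) : basis_code p \in basis_codes.
Proof.
by apply: allpairs_f; [apply: shift_lt | apply: code_S3 (subgP _)].
Qed.

Lemma card_bismash_basis : #|{: B}| = 24.
Proof.
rewrite card_prod !card_sub mulnC; have /complP[tiFG defT] := S3_C4_factorization.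
by rewrite -TI_cardMg // defT cardsT card_Sn.
Qed.

(** Injectivity and the cardinality 24 = |S_4| = |S_3| |C_4| suffice: no
    permutation has to be built from its code. *)
Lemma codom_basis_code : codom basis_code =i basis_codes.
Proof.
have uniq_map : uniq (codom basis_code).
  by rewrite map_inj_uniq ?enum_uniq //; apply: basis_code_inj.
have sub : {subset codom basis_code <= basis_codes}.
  by move=> c /codomP[p ->]; apply: basis_code_mem.
have size24 : size basis_codes <= size (codom basis_code).
  by rewrite size_codom card_bismash_basis.
by have [] := uniq_min_size uniq_map sub size24.
Qed.

Lemma bismash_powE (n : nat) (p q : B) :
  bismash_pow n p q = code_pow n (basis_code p) (basis_code q).
Proof.
elim: n => [|n IHn] in p q *.
  case: p q => [x a] [u w] /=; congr (_ && _); apply/eqP/eqP.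
  - by move=> ->; rewrite /shift lperm1.
  - move=> x0; apply/val_inj/shift_inj; rewrite ?subgP //.
    by rewrite x0 /shift lperm1.
  - by move=> ->; rewrite code1.
  by rewrite -[[:: _; _; _; _]]code1 => /code_inj w1; apply: val_inj.
rewrite /= IHn /basis_code /=.
rewrite -(shift_div (subgP q.1) (subgP p.1)) code_div.
case: (mp_code (q.1^-1 * p.1)%g p.2) => <- _.
by case: (mp_code q.1 (mp_left (q.1^-1 * p.1)%g p.2)) => _ <-.
Qed.
End Codes.

(** * Deciding Hopf orders from integer matrices *)

(** A Hopf algebra over the rationals is given here by 0-1 matrices [K n] of its
    Hopf powers, with the basis labelled by a list of codes on which everything
    computes. *)
Section Certificates.

Variables (H : hopf_algebra rat) (C : eqType) (enc : hbasis H -> C).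
Variables (codes : seq C) (K : nat -> C -> C -> bool).
Hypothesis enc_inj : injective enc.
Hypothesis enc_codes : codom enc =i codes.
Hypothesis coefE : forall n b c,
  hopf_coef (H := H) n b c = (K n (enc b) (enc c))%:R.

Local Notation V := {ffun hbasis H -> rat^o}.

(** The sum is a right fold because it has to reduce by evaluation. *)
Definition lin_comb (s : seq (int * C)) (f : C -> int) : int :=
  foldr +%R 0 [seq z.1 * f z.2 | z <- s].

(** The matrix of h |-> h^[n] - eps(h) 1. *)
Definition defect (n : nat) (p q : C) : int := (K n p q)%:Z - (K 0 p q)%:Z.

Definition supported (s : seq (int * C)) : bool :=
  all (fun z => z.2 \in codes) s.

Definition sparse_vector (s : seq (int * C)) : V :=
  [ffun b => (lin_comb s (fun p => (enc b == p)%:Z))%:~R].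

Definition trivial_code (n : nat) (s : seq (int * C)) : bool :=
  all (fun q => lin_comb s (defect n ^~ q) == 0) codes.

Definition order_code (n : nat) (s : seq (int * C)) : bool :=
  [&& (0 < n)%N, supported s, trivial_code n s
    & all (fun m => ~~ trivial_code m s) (iota 1 n.-1)].

(** A certificate [D] lists columns of the m-th defect matrix, each with its
    expression as a combination of columns of the n-th one; columns absent from
    [D] have to vanish. *)
Definition kernel_code (n m : nat) (D : seq (C * seq (int * C))) : bool :=
  all (fun q =>
    let s := flatten [seq z.2 | z <- D & z.1 == q] in
    supported s && all (fun p => defect m p q == lin_comb s (defect n p)) codes)
  codes.

Lemma enc_mem (b : hbasis H) : enc b \in codes.
Proof. by rewrite -enc_codes codom_f. Qed.

Lemma lin_combE (s : seq (int * C)) (f : C -> int) :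
  lin_comb s f = \sum_(z <- s) z.1 * f z.2.
Proof. by rewrite /lin_comb foldrE big_map. Qed.

Lemma trivial_defect (n : nat) (h : V) :
  hopf_power_trivial n h <->
  forall c, \sum_b h b * (defect n (enc b) (enc c))%:~R = 0.
Proof.
apply: (iff_trans (hopf_power_trivialP n h)).
by split=> eq0 c; rewrite -[RHS](eq0 c); apply: eq_bigr => b _;
  rewrite !coefE intrB.
Qed.

Lemma sum_sparse (s : seq (int * C)) (f : C -> int) :
  supported s ->
  \sum_b sparse_vector s b * (f (enc b))%:~R = (lin_comb s f)%:~R :> rat.
Proof.
move=> /allP suppS; rewrite lin_combE rmorph_sum /=.
under eq_bigr do rewrite ffunE lin_combE rmorph_sum mulr_suml.
rewrite exchange_big; apply: eq_big_seq => z /suppS.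
rewrite -enc_codes => /codomP[b ->].
rewrite (bigD1 b) //= eqxx mulr1 intrM big1 ?addr0 // => c neq_cb.
by rewrite (inj_eq enc_inj) (negPf neq_cb) mulr0 mul0r.
Qed.

Lemma trivial_codeP (n : nat) (s : seq (int * C)) :
  supported s -> reflect (hopf_power_trivial n (sparse_vector s)) (trivial_code n s).
Proof.
move=> suppS; apply: (iffP allP) => [eq0 | /trivial_defect eq0 q].
  apply/trivial_defect=> c; rewrite (sum_sparse (defect n ^~ (enc c)) suppS).
  by rewrite (eqP (eq0 _ (enc_mem c))).
rewrite -enc_codes => /codomP[c ->].
have := eq0 c; rewrite (sum_sparse (defect n ^~ (enc c)) suppS) => /eqP.
by rewrite intr_eq0.
Qed.

Lemma order_codeP (n : nat) (s : seq (int * C)) :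
  order_code n s -> exists h : V, has_hopf_order H h n.
Proof.
case/and4P=> n_gt0 suppS /(trivial_codeP _ suppS) triv /allP nontriv.
exists (sparse_vector s); split=> // m /andP[m_gt0 lt_mn].
move=> /(trivial_codeP _ suppS); apply/negP/nontriv.
by rewrite mem_iota m_gt0 add1n prednK.
Qed.

(** The coordinates of the m-th defect of h are combinations of those of the
    n-th defect, so they vanish together. *)
Lemma kernel_codeP (n m : nat) (D : seq (C * seq (int * C))) (h : V) :
  kernel_code n m D -> hopf_power_trivial n h -> hopf_power_trivial m h.
Proof.
move=> /allP certD /trivial_defect eq0; apply/trivial_defect=> c.
have /andP[/allP suppS /allP eq_c] := certD _ (enc_mem c).
set s := flatten _ in suppS eq_c.
under eq_bigr do rewrite (eqP (eq_c _ (enc_mem _))) lin_combE rmorph_sum /= mulr_sumr.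
rewrite exchange_big big_seq big1 // => z /suppS.
rewrite -enc_codes => /codomP[d ->].
under eq_bigr do rewrite intrM mulrCA.
by rewrite -mulr_sumr eq0 mulr0.
Qed.

Lemma no_order (n m : nat) (D : seq (C * seq (int * C))) :
  (0 < m < n)%N -> kernel_code n m D -> ~ exists h : V, has_hopf_order H h n.
Proof.
move=> lt_mn certD [h [_ triv nontriv]].
exact: nontriv lt_mn (kernel_codeP certD triv).
Qed.

(** An element of Hopf order n excludes every smaller exponent at once. *)
Lemma exponent_code (n : nat) (s : seq (int * C)) :
  all (fun p => all (fun q => K n p q == K 0 p q) codes) codes ->
  order_code n s -> has_exponent H n.
Proof.
move=> /allP periodic ord; have [h0 [n_gt0 _ nontriv]] := order_codeP ord.
split=> // [h | m lt_mn triv]; last exact: nontriv lt_mn (triv _).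
apply/trivial_defect=> c; apply: big1 => b _.
have /allP/(_ _ (enc_mem c))/eqP := periodic _ (enc_mem b).
by rewrite /defect => ->; rewrite subrr mulr0.
Qed.

End Certificates.

(** * Witnesses and certificates *)

(** The codes of the elements of S_3. The names use the points 1, 2, 3 while
    the codes count from 0; r123 is the cycle (1 2 3). *)
Definition id3 : seq nat := [:: 0; 1; 2; 3]%N.
Definition s12 : seq nat := [:: 1; 0; 2; 3]%N.
Definition s13 : seq nat := [:: 2; 1; 0; 3]%N.
Definition s23 : seq nat := [:: 0; 2; 1; 3]%N.
Definition r123 : seq nat := [:: 1; 2; 0; 3]%N.
Definition r132 : seq nat := [:: 2; 0; 1; 3]%N.

Local Notation vec := (seq (int * (nat * seq nat))).
Local Notation cert := (seq ((nat * seq nat) * vec)).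

Definition dual_pow (n : nat) (p q : nat * seq nat) : bool := code_pow n q p.

Local Notation dual := (hopf_dual bismash_C4_S3).

Lemma coefE_H (n : nat) (b c : hbasis bismash_C4_S3) :
  hopf_coef n b c = (code_pow n (basis_code b) (basis_code c))%:R.
Proof. by rewrite hopf_coef_bismash bismash_powE. Qed.

Lemma coefE_dual (n : nat) (b c : hbasis bismash_C4_S3) :
  hopf_coef (H := dual) n b c = (dual_pow n (basis_code b) (basis_code c))%:R.
Proof. by rewrite hopf_coef_dual coefE_H. Qed.

(** The code (i, a) stands for p_x # a with x the i-th power of (1 2 3 4). Among
    the first eleven Hopf powers, that of (1, r123) is trivial exactly for
    n = 2, 5, 6, 8, 9, that of (0, id3) for 4, 8, that of (1, s12) for 3, 9, and
    that of (1, s23) for 3, 4, 6, 7, 10. Where no cancellation occurs, a sum of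
    two basis vectors has trivial n-th power only for the common values of n;
    this gives the orders 6, 8 and 9. For the order 5, the fifth defects of
    (1, s23) and (2, r123) are equal and not zero, so they cancel in the
    difference, while their second defects do not; for n = 3 and 4 they cancel
    as well, but (1, r123) remains. The witness for 1 is the unit element. *)
Definition witness_H (n : nat) : vec :=
  match n with
  | 1%N => [:: (1, (0, id3)); (1, (1, id3)); (1, (2, id3)); (1, (3, id3))]
  | 2%N => [:: (1, (0, s13))]
  | 3%N => [:: (1, (1, s12))]
  | 4%N => [:: (1, (0, id3))]
  | 5%N => [:: (-1, (1, s23)); (1, (1, r123)); (1, (2, r123))]
  | 6%N => [:: (1, (1, s23)); (1, (1, r123))]
  | 8%N => [:: (1, (0, id3)); (1, (1, r123))]
  | 9%N => [:: (1, (1, s12)); (1, (1, r123))]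
  | _ => [::]
  end.

(** The code (i, a) stands for the functional dual to p_x # a, and the witness
    for 1 is the counit. For the order 8, (1, r123) has trivial n-th power,
    n < 12, exactly for n = 2, 5, 6, 8, 9 and (1, s13) for n = 4, 8. For the order 5,
    the fifth defects of (1, s23) and (2, r123) cancel again. The witness
    for 10 is a sum of vectors whose tenth defects are not zero but cancel. *)
Definition witness_dual (n : nat) : vec :=
  match n with
  | 1%N => [:: (1, (0, id3)); (1, (0, s12)); (1, (0, s13)); (1, (0, s23));
               (1, (0, r123)); (1, (0, r132))]
  | 2%N => [:: (1, (0, s23))]
  | 3%N => [:: (1, (0, r123))]
  | 4%N => [:: (1, (1, s13))]
  | 5%N => [:: (-1, (1, s23)); (1, (1, r123)); (1, (2, r123))]
  | 6%N => [:: (1, (0, id3))]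
  | 8%N => [:: (1, (1, r123)); (1, (1, s13))]
  | 10%N => [:: (1, (0, id3)); (2, (0, r123)); (-1, (1, id3)); (1, (3, id3))]
  | _ => [::]
  end.

(** The coordinates of the sixth defect in terms of those of the seventh. The
    six rows are all the nonzero coordinates of the sixth defect. *)
Definition cert_H_7 : cert :=
  [:: ((1, id3), [:: (-1, (0, id3)); (-1, (0, r132)); (1, (2, id3))]);
      ((1, s13), [:: (1, (3, r123))]);
      ((2, id3), [:: (-1, (0, s23)); (-1, (0, s12))]);
      ((2, s13), [:: (1, (1, s12)); (1, (3, s23))]);
      ((3, id3), [:: (-1, (0, id3)); (-1, (0, r123)); (1, (2, id3))]);
      ((3, s13), [:: (1, (1, r132))])].

Definition cert_H_10 : cert :=
  [:: ((1, id3), [:: (1, (0, id3)); (1, (1, id3)); (-1, (2, id3))]);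
      ((1, s13), [:: (1, (1, s13))]);
      ((2, id3), [:: (-1, (0, id3)); (1, (2, id3))]);
      ((2, s13), [:: (1, (2, s13))]);
      ((3, id3), [:: (1, (0, id3)); (-1, (2, id3)); (1, (3, id3))]);
      ((3, s13), [:: (1, (3, s13))])].

(** In the dual, the ten nonzero coordinates of the sixth defect are, up to
    sign, the coefficients at (1, id3), (2, id3), (3, id3), (1, s13), (2, s13),
    (3, s13) and the sum of the first and the third of them; so several rows
    are equal up to sign. *)
Definition cert_dual_7 : cert :=
  [:: ((0, id3), [:: (1, (0, id3)); (1, (2, id3))]);
      ((0, s23), [:: (-1, (2, id3))]);
      ((0, s12), [:: (-1, (2, id3))]);
      ((0, r123), [:: (-1, (1, id3))]);
      ((0, r132), [:: (-1, (3, id3))]);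
      ((1, s12), [:: (1, (2, s13))]);
      ((1, r132), [:: (1, (3, s13))]);
      ((2, id3), [:: (-1, (0, id3)); (-1, (2, id3))]);
      ((3, s23), [:: (1, (2, s13))]);
      ((3, r123), [:: (1, (1, s13))])].

Definition cert_dual_9 : cert :=
  [:: ((0, id3), [:: (1, (0, r123))]);
      ((0, s23), [:: (-1, (2, id3))]);
      ((0, s12), [:: (-1, (2, id3))]);
      ((0, r123), [:: (-1, (3, id3))]);
      ((0, r132), [:: (-1, (1, id3))]);
      ((1, s12), [:: (1, (2, s13))]);
      ((1, r132), [:: (1, (3, s13))]);
      ((2, id3), [:: (-1, (0, r123))]);
      ((3, s23), [:: (1, (2, s13))]);
      ((3, r123), [:: (1, (1, s13))])].

Lemma order_H (n : nat) :
  n \in [:: 1; 2; 3; 4; 5; 6; 8; 9]%N ->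
  exists h : bismash_C4_S3, has_hopf_order bismash_C4_S3 h n.
Proof.
have check : all (fun n => order_code basis_codes code_pow n (witness_H n))
  [:: 1; 2; 3; 4; 5; 6; 8; 9]%N by vm_compute.
move=> /(allP check) ord.
exact: (order_codeP (H := bismash_C4_S3) basis_code_inj codom_basis_code coefE_H ord).
Qed.

Lemma exponent_H : has_exponent bismash_C4_S3 12.
Proof.
apply: (exponent_code (H := bismash_C4_S3) (s := [:: (1, (0%N, s23))])
  basis_code_inj codom_basis_code coefE_H); by vm_compute.
Qed.

Lemma no_order_H (n : nat) :
  n \in [:: 7; 10]%N ->
  ~ exists h : bismash_C4_S3, has_hopf_order bismash_C4_S3 h n.
Proof.
pose D n := if n == 7%N then cert_H_7 else cert_H_10.
have check : all (fun n => kernel_code basis_codes code_pow n 6 (D n))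
  [:: 7; 10]%N by vm_compute.
move=> n_in; apply: (no_order (H := bismash_C4_S3) codom_basis_code coefE_H _
  (allP check _ n_in)).
by move: n_in; rewrite !inE => /orP[] /eqP->.
Qed.

Lemma order_dual (n : nat) :
  n \in [:: 1; 2; 3; 4; 5; 6; 8; 10]%N ->
  exists f : dual, has_hopf_order dual f n.
Proof.
have check : all (fun n => order_code basis_codes dual_pow n (witness_dual n))
  [:: 1; 2; 3; 4; 5; 6; 8; 10]%N by vm_compute.
move=> /(allP check) ord.
exact: (order_codeP (H := dual) basis_code_inj codom_basis_code coefE_dual ord).
Qed.

Lemma no_order_dual (n : nat) :
  n \in [:: 7; 9]%N -> ~ exists f : dual, has_hopf_order dual f n.
Proof.
pose D n := if n == 7%N then cert_dual_7 else cert_dual_9.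
have check : all (fun n => kernel_code basis_codes dual_pow n 6 (D n))
  [:: 7; 9]%N by vm_compute.
move=> n_in; apply: (no_order (H := dual) codom_basis_code coefE_dual _
  (allP check _ n_in)).
by move: n_in; rewrite !inE => /orP[] /eqP->.
Qed.

Lemma dim_hopf_space (k : fieldType) (A : hopf_algebra k) :
  \dim {: hopf_space A} = #|hbasis A|.
Proof. by rewrite dimvf /dim /= muln1. Qed.

Theorem corollary3p4 :
  let H := bismash_C4_S3 in
  let H' := hopf_dual bismash_C4_S3 in
  [/\ \dim {: hopf_space H} = 24%N,
      has_exponent H 12,
      forall n : nat, (1 <= n <= 10)%N ->
        ((exists h : H, has_hopf_order H h n) <-> (n <> 7%N /\ n <> 10%N)) &
      exists (p : nat) (h : H),
        [/\ prime p, has_hopf_order H h p,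
            ~~ (p %| \dim {: hopf_space H})%N & ~~ (p %| 12)%N]]
  /\
  (forall n : nat, (1 <= n <= 10)%N ->
     ((exists f : H', has_hopf_order H' f n) <-> (n <> 7%N /\ n <> 9%N)))
  /\
  ~ (forall n : nat,
       (exists h : H, has_hopf_order H h n) <->
       (exists f : H', has_hopf_order H' f n)).
Proof.
have dimH : \dim {: hopf_space bismash_C4_S3} = 24%N.
  by rewrite dim_hopf_space card_bismash_basis.
move=> H H'; split; [split | split] => //.
- exact: exponent_H.
- move=> n le_n; split=> [ord | [n7 n10]].
    by split=> def_n; apply: no_order_H ord; rewrite def_n.
  by apply: order_H; move: n le_n n7 n10; do 11!case=> //.
- have [h ord5] := @order_H 5%N isT.
  by exists 5%N, h; rewrite dimH.
- move=> n le_n; split=> [ord | [n7 n9]].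
    by split=> def_n; apply: no_order_dual ord; rewrite def_n.
  by apply: order_dual; move: n le_n n7 n9; do 11!case=> //.
by move=> same; apply: (@no_order_H 10%N isT); apply/same/order_dual.
Qed.
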